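(* $V_8=\displaystyle\inf_{a\in[1.6566924,\,1.8191095]}\frac{\chi_8(a)}{(\sqrt a-1)^2}$.
   Context: For an integer $n\ge 2$, $C_n$ denotes the set of real cosine polynomials $f(\phi)=\sum_{k=0}^{n} a_k\cos(k\phi)$ such that (i) all coefficients are real and nonnegative, (ii) $a_1>a_0>0$, and (iii) $f(\phi)\ge 0$ for all real $\phi$. For $f\in C_n$, $v(f)=\dfrac{f(0)-a_0}{(\sqrt{a_1}-\sqrt{a_0})^2}$ and $V_n=\inf_{f\in C_n}v(f)$. For $a\in\left(1,2\cos\frac{\pi}{n+2}\right]$, $\chi_n(a)=\inf\{f(0)-1 : f\in C_n,\ a_0(f)=1,\ a_1(f)=a\}$, where $a_k(f)$ is the $k$-th cosine coefficient of $f$. Numerical constants are decimal values as given in the paper, to seven decimal places. *)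

(* Defs.v *)
From Stdlib Require Import Reals.
From Coquelicot Require Import Coquelicot.
Open Scope R_scope.

(* A cosine polynomial is represented by its sequence [c] of cosine
   coefficients.  [InC] forces [c k = 0] for k > n, so that sequences in C_n
   and the functions they define correspond bijectively.
   Note that [sum_f_R0 u n] is u 0 + ... + u n. *)
Definition cos_poly (n : nat) (c : nat -> R) (phi : R) : R :=
  sum_f_R0 (fun k => c k * cos (INR k * phi)) n.

Record InC (n : nat) (c : nat -> R) : Prop := {
  InC_degree : forall k, (n < k)%nat -> c k = 0;
  InC_coef_ge0 : forall k, 0 <= c k;
  InC_a0_pos : 0 < c 0%nat;
  InC_a0_lt_a1 : c 0%nat < c 1%nat;
  InC_nonneg : forall phi, 0 <= cos_poly n c phi
}.

Definition v (n : nat) (c : nat -> R) : R :=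
  (cos_poly n c 0 - c 0%nat) / (sqrt (c 1%nat) - sqrt (c 0%nat)) ^ 2.

(* Infima are taken in the extended reals, so they never take a default
   value: the infimum of the empty set is +oo. *)
Definition V (n : nat) : Rbar :=
  Glb_Rbar (fun y => exists c, InC n c /\ y = v n c).

(* Defined for every real a; the admissible range is
   1 < a <= 2 cos (PI / (n + 2)), beyond which no polynomial qualifies. *)
Definition chi (n : nat) (a : R) : Rbar :=
  Glb_Rbar (fun y => exists c, InC n c /\ c 0%nat = 1 /\ c 1%nat = a /\
                               y = cos_poly n c 0 - 1).

(* Main.v *)
Require Import Defs.
From Stdlib Require Import Reals Lra Lia.
From Coquelicot Require Import Coquelicot.
Open Scope R_scope.

(** Scaling a polynomial to [a_0 = 1] identifies [V n] with the infimum of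
    [chi n a / (sqrt a - 1)^2] over all [a > 1], so it suffices that polynomials
    with [a_1 / a_0] outside the given interval cannot compete.  A square
    [|h(e^{i phi})|^2] with integer [h] and [a_1 / a_0 = 1.727...] has [v < 34.7].
    Evaluating [f >= 0] at a few angles with rational cosine and combining with
    [a_k >= 0] (linear programming duality) gives linear lower bounds
    [f(0) - a_0 >= p a_1 - m a_0], which force [v f >= 34.7] outside the
    interval. *)

(** * Cosine polynomials through Chebyshev polynomials of the first kind *)

Fixpoint cheb (k : nat) (x : R) : R :=
  match k with
  | 0 => 1
  | S j => match j with 0 => x | S i => 2 * x * cheb j x - cheb i x end
  end.

Lemma cos_cheb (k : nat) (phi : R) : cos (INR k * phi) = cheb k (cos phi).
Proof.
enough (cos (INR k * phi) = cheb k (cos phi) /\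
        cos (INR (S k) * phi) = cheb (S k) (cos phi)) by tauto.
induction k as [|k [IH1 IH2]].
- split; simpl; [rewrite Rmult_0_l; apply cos_0|now rewrite Rmult_1_l].
- split; [exact IH2|].
  change (cheb (S (S k)) (cos phi))
    with (2 * cos phi * cheb (S k) (cos phi) - cheb k (cos phi)).
  rewrite <- IH1, <- IH2.
  replace (INR (S (S k)) * phi) with (INR (S k) * phi + phi)
    by (rewrite !S_INR; ring).
  replace (INR k * phi) with (INR (S k) * phi - phi) by (rewrite !S_INR; ring).
  rewrite cos_plus, cos_minus; ring.
Qed.

Lemma cos_poly_cheb (n : nat) (c : nat -> R) (phi : R) :
  cos_poly n c phi = sum_f_R0 (fun k => c k * cheb k (cos phi)) n.
Proof. apply sum_eq; intros k _; now rewrite cos_cheb. Qed.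

Lemma cos_poly_at_0 (n : nat) (c : nat -> R) : cos_poly n c 0 = sum_f_R0 c n.
Proof. apply sum_eq; intros k _; rewrite Rmult_0_r, cos_0; ring. Qed.

(** Nonnegativity at [acos x]. For rational [x] this is a linear condition on the coefficients with
    rational weights, free of trigonometry. *)
Lemma cheb_sum_ge0 (n : nat) (c : nat -> R) (x : R) :
  InC n c -> -1 <= x <= 1 -> 0 <= sum_f_R0 (fun k => c k * cheb k x) n.
Proof.
intros Hc Hx; generalize (InC_nonneg _ _ Hc (acos x)).
now rewrite cos_poly_cheb, cos_acos.
Qed.

(** * Scaling and the reduction of [V] to [chi] *)

Lemma cos_poly_scale (n : nat) (k : R) (c : nat -> R) (phi : R) :
  cos_poly n (fun i => k * c i) phi = k * cos_poly n c phi.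
Proof.
unfold cos_poly; rewrite scal_sum; apply sum_eq; intros i _; ring.
Qed.

Lemma InC_scale (n : nat) (k : R) (c : nat -> R) :
  0 < k -> InC n c -> InC n (fun i => k * c i).
Proof.
intros Hk [Hdeg Hge0 Hpos Hlt Hnonneg]; split.
- intros i Hi; rewrite (Hdeg i Hi); ring.
- intros i; apply Rmult_le_pos; [lra|apply Hge0].
- now apply Rmult_lt_0_compat.
- now apply Rmult_lt_compat_l.
- intros phi; rewrite cos_poly_scale; apply Rmult_le_pos; [lra|apply Hnonneg].
Qed.

Lemma v_scale (n : nat) (k : R) (c : nat -> R) :
  0 < k -> InC n c -> v n (fun i => k * c i) = v n c.
Proof.
intros Hk [_ Hge0 Hpos Hlt _].
assert (Hs : sqrt (c 0%nat) < sqrt (c 1%nat)) by (apply sqrt_lt_1; lra).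
assert (Hk' : 0 < sqrt k) by now apply sqrt_lt_R0.
unfold v; rewrite cos_poly_scale, !sqrt_mult by (try apply Hge0; lra).
replace k with (sqrt k * sqrt k) at 1 2 by (apply sqrt_sqrt; lra).
field; split; [lra|].
rewrite <- Rmult_minus_distr_l; apply Rmult_integral_contrapositive; lra.
Qed.

Lemma v_unit (n : nat) (c : nat -> R) (a : R) :
  c 0%nat = 1 -> c 1%nat = a ->
  v n c = (cos_poly n c 0 - 1) / (sqrt a - 1) ^ 2.
Proof. intros H0 H1; unfold v; now rewrite H0, H1, sqrt_1. Qed.

(** Passes to [Rbar_div_pos], which is monotone and computes directly at infinite values. *)
Lemma Rbar_div_pos_eq_div (x : Rbar) (k : posreal) :
  Rbar_div x (Finite k) = Rbar_div_pos x k.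
Proof.
destruct k as [k Hk]; destruct x as [x| |]; simpl; [reflexivity| |];
  unfold Rbar_div; simpl; destruct (Rle_dec 0 (/ k)) as [H|H];
  try (exfalso; apply H, Rlt_le, Rinv_0_lt_compat, Hk);
  destruct (Rle_lt_or_eq_dec 0 (/ k) H) as [H'|H'];
  solve [reflexivity | exfalso; generalize (Rinv_0_lt_compat _ Hk); lra].
Qed.

Lemma chi_div_le_v (n : nat) (c : nat -> R) :
  InC n c ->
  Rbar_le (Rbar_div (chi n (c 1%nat / c 0%nat))
                    (Finite ((sqrt (c 1%nat / c 0%nat) - 1) ^ 2)))
          (Finite (v n c)).
Proof.
intros Hc; set (a := c 1%nat / c 0%nat).
pose proof (InC_a0_pos _ _ Hc) as H0; pose proof (InC_a0_lt_a1 _ _ Hc) as H1.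
assert (Ha : 1 < a) by (apply Rlt_div_r; lra).
assert (Hs : 1 < sqrt a) by (rewrite <- sqrt_1 at 1; apply sqrt_lt_1; lra).
assert (Hk : 0 < (sqrt a - 1) ^ 2) by (apply pow_lt; lra).
assert (Hi : 0 < / c 0%nat) by now apply Rinv_0_lt_compat.
(* Dividing [c] by its constant coefficient keeps [v] and yields a competitor for [chi n a]. *)
rewrite <- (v_scale n (/ c 0%nat)) by assumption.
rewrite (v_unit n _ a) by (unfold a; field; lra).
change (Finite ((sqrt a - 1) ^ 2)) with (Finite (mkposreal _ Hk)).
rewrite Rbar_div_pos_eq_div.
change (Finite ((cos_poly n (fun i => / c 0%nat * c i) 0 - 1) / (sqrt a - 1) ^ 2))
  with (Rbar_div_pos (cos_poly n (fun i => / c 0%nat * c i) 0 - 1)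
          (mkposreal _ Hk)).
apply Rbar_div_pos_le, Glb_Rbar_correct.
exists (fun i => / c 0%nat * c i); split; [now apply InC_scale|].
repeat split; unfold a; field; lra.
Qed.

Lemma V_le_chi_div (n : nat) (a : R) :
  1 < a -> Rbar_le (V n) (Rbar_div (chi n a) (Finite ((sqrt a - 1) ^ 2))).
Proof.
intros Ha.
assert (Hs : 1 < sqrt a) by (rewrite <- sqrt_1 at 1; apply sqrt_lt_1; lra).
assert (Hk : 0 < (sqrt a - 1) ^ 2) by (apply pow_lt; lra).
change (Finite ((sqrt a - 1) ^ 2)) with (Finite (mkposreal _ Hk)).
rewrite Rbar_div_pos_eq_div.
(* Once the denominator is cleared, the right side is the bare infimum [chi n a], so it suffices to
   bound each of its competitors. *)
apply (Rbar_mult_pos_le _ _ (mkposreal _ Hk)).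
replace (Rbar_mult_pos (Rbar_div_pos (chi n a) (mkposreal _ Hk)) (mkposreal _ Hk))
  with (chi n a).
2: { destruct (chi n a) as [x| |]; simpl; [|reflexivity|reflexivity].
     f_equal; field; lra. }
apply Glb_Rbar_correct; intros y (c & Hc & H0 & H1 & ->).
assert (HV : Rbar_le (V n) (v n c)) by (apply Glb_Rbar_correct; now exists c).
apply (Rbar_mult_pos_le _ _ (mkposreal _ Hk)) in HV.
rewrite (v_unit n c a H0 H1) in HV; simpl in HV.
replace (cos_poly n c 0 - 1)
  with ((cos_poly n c 0 - 1) / ((sqrt a - 1) * ((sqrt a - 1) * 1))
        * ((sqrt a - 1) * ((sqrt a - 1) * 1))) by (field; lra).
exact HV.
Qed.

(** A polynomial with ratio in [I] is bounded below through [chi] at its own ratio; any other one is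
    beaten by [c0], whose ratio lies in [I]. *)
Lemma V_eq_glb (n : nat) (I : R -> Prop) (c0 : nat -> R) :
  (forall a, I a -> 1 < a) -> InC n c0 -> I (c0 1%nat / c0 0%nat) ->
  (forall c, InC n c -> ~ I (c 1%nat / c 0%nat) -> v n c0 <= v n c) ->
  V n = Rbar_glb (fun y : Rbar => exists a : R, I a /\
          y = Rbar_div (chi n a) (Finite ((sqrt a - 1) ^ 2))).
Proof.
intros HI Hc0 HIc0 Hout; symmetry; apply Rbar_is_glb_unique; split.
- intros y (a & Ha & ->); now apply V_le_chi_div, HI.
- intros b Hb; apply Glb_Rbar_correct; intros y (c & Hc & ->).
  destruct (Classical_Prop.classic (I (c 1%nat / c 0%nat))) as [HIc|HIc].
  + eapply Rbar_le_trans; [|now apply chi_div_le_v].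
    apply Hb; eauto.
  + apply Rbar_le_trans with (v n c0); [|now apply Hout].
    eapply Rbar_le_trans; [|now apply chi_div_le_v].
    apply Hb; eauto.
Qed.

(** * Linear lower bounds and exclusion of the outer ratios *)

Ltac coefs_ge0 Hc :=
  pose proof (InC_coef_ge0 _ _ Hc 0); pose proof (InC_coef_ge0 _ _ Hc 1);
  pose proof (InC_coef_ge0 _ _ Hc 2); pose proof (InC_coef_ge0 _ _ Hc 3);
  pose proof (InC_coef_ge0 _ _ Hc 4); pose proof (InC_coef_ge0 _ _ Hc 5);
  pose proof (InC_coef_ge0 _ _ Hc 6); pose proof (InC_coef_ge0 _ _ Hc 7);
  pose proof (InC_coef_ge0 _ _ Hc 8).

Ltac ge0_at Hc x :=
  let H := fresh in
  assert (H := cheb_sum_ge0 8 _ x Hc ltac:(lra));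
  cbn [sum_f_R0 cheb] in H.

(* The nodes [x] and the constants in the bounds below come from a numerical
   solution of the dual linear program on a grid; [lra] recovers the weights. *)

Lemma dual_bound_small (c : nat -> R) :
  InC 8 c -> 2 * c 1%nat - c 0%nat <= cos_poly 8 c 0 - c 0%nat.
Proof.
intros Hc; rewrite cos_poly_at_0; coefs_ge0 Hc.
ge0_at Hc (-1).
cbn [sum_f_R0]; lra.
Qed.

Lemma dual_bound_left (c : nat -> R) :
  InC 8 c ->
  5.649 * c 1%nat - 6.488 * c 0%nat <= cos_poly 8 c 0 - c 0%nat.
Proof.
intros Hc; rewrite cos_poly_at_0; coefs_ge0 Hc.
ge0_at Hc (-1); ge0_at Hc (-9/10); ge0_at Hc (-8/10); ge0_at Hc (-4/10).
cbn [sum_f_R0]; lra.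
Qed.

Lemma dual_bound_right (c : nat -> R) :
  InC 8 c ->
  12.285 * c 1%nat - 17.898 * c 0%nat <= cos_poly 8 c 0 - c 0%nat.
Proof.
intros Hc; rewrite cos_poly_at_0; coefs_ge0 Hc.
ge0_at Hc (-1); ge0_at Hc (-9/10); ge0_at Hc (-6/10); ge0_at Hc (-5/10);
  ge0_at Hc 0.
cbn [sum_f_R0]; lra.
Qed.

(** A crude cap on the ratio: [dual_bound_right] forces a large [v] only on a bounded range of
    ratios. *)
Lemma a1_le_3a0 (c : nat -> R) : InC 8 c -> c 1%nat <= 3 * c 0%nat.
Proof.
intros Hc; coefs_ge0 Hc.
ge0_at Hc (-1); ge0_at Hc (-9/10); ge0_at Hc (-5/10); ge0_at Hc (1/10);
  ge0_at Hc (7/10).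
lra.
Qed.

Lemma v_outside (c : nat -> R) :
  InC 8 c -> ~ 1.6566924 <= c 1%nat / c 0%nat <= 1.8191095 ->
  34.7 <= v 8 c.
Proof.
intros Hc Hout.
pose proof (InC_a0_pos _ _ Hc) as H0; pose proof (InC_a0_lt_a1 _ _ Hc) as H1.
assert (Hout' : c 1%nat < 1.6566924 * c 0%nat \/ 1.8191095 * c 0%nat < c 1%nat).
{ destruct (Rlt_or_le (c 1%nat) (1.6566924 * c 0%nat)) as [H|H]; [now left|].
  destruct (Rlt_or_le (1.8191095 * c 0%nat) (c 1%nat)) as [H'|H']; [now right|].
  exfalso; apply Hout; split; [apply -> Rle_div_r|apply <- Rle_div_l]; lra. }
pose proof (dual_bound_small c Hc) as Bs.
pose proof (dual_bound_left c Hc) as Bl.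
pose proof (dual_bound_right c Hc) as Br.
pose proof (a1_le_3a0 c Hc) as B3.
unfold v.
assert (Ht : 0 < sqrt (c 0%nat)) by now apply sqrt_lt_R0.
assert (Hs : sqrt (c 0%nat) < sqrt (c 1%nat)) by (apply sqrt_lt_1; lra).
assert (Et : sqrt (c 0%nat) * sqrt (c 0%nat) = c 0%nat)
  by (apply sqrt_sqrt; lra).
assert (Es : sqrt (c 1%nat) * sqrt (c 1%nat) = c 1%nat)
  by (apply sqrt_sqrt; lra).
apply -> Rle_div_r; [|apply pow_lt; lra].
(* In [s] and [t] every bound is quadratic and no square root remains. *)
set (t := sqrt (c 0%nat)) in *; set (s := sqrt (c 1%nat)) in *; clearbody t s.
rewrite <- Et, <- Es in *; clear Et Es.
destruct Hout' as [H|H].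
(* On each range of [s / t], the linear bound minus [34.7 * (s - t) ^ 2] is a concave quadratic,
   positive at both ends. The product of the distances to the ends is the hint that [nra] needs. The
   bound [dual_bound_small] serves up to 1.23, [dual_bound_left] from there to 1.2872. *)
- assert (s <= 1.2872 * t) by nra.
  destruct (Rle_lt_dec s (1.23 * t)).
  + assert (0 <= (s - t) * (1.23 * t - s)) by nra; nra.
  + assert (0 <= (s - 1.23 * t) * (1.2872 * t - s)) by nra; nra.
- assert (1.34 * t <= s) by nra.
  (* Here 1.74 is just above the square root of 3. *)
  assert (s <= 1.74 * t) by nra.
  assert (0 <= (s - 1.34 * t) * (1.74 * t - s)) by nra; nra.
Qed.

(** * An explicit competitor with ratio inside the interval *)

(* Autocorrelations of [h = (1, 0, -3, 5, 29, 55, 62, 44, 17)], i.e. the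
   coefficients of [|sum_j h_j e^{i j phi}|^2]. *)
Definition good (k : nat) : R :=
  match k with
  | 0 => 9970 | 1 => 17222 | 2 => 10914 | 3 => 4722 | 4 => 1112
  | 5 => 16 | 6 => 22 | 7 => 88 | 8 => 34 | _ => 0
  end.

Lemma InC_good : InC 8 good.
Proof.
split.
- intros k Hk; do 9 (destruct k as [|k]; [lia|]); reflexivity.
- intros k; do 9 (destruct k as [|k]; [simpl; lra|]); simpl; lra.
- simpl; lra.
- simpl; lra.
- intros phi; rewrite cos_poly_cheb; set (x := cos phi).
  assert (Hx : 0 <= 1 - x ^ 2) by (generalize (COS_bound phi); fold x; nra).
  set (A := 1 - 3 * cheb 2 x + 5 * cheb 3 x + 29 * cheb 4 x + 55 * cheb 5 x
            + 62 * cheb 6 x + 44 * cheb 7 x + 17 * cheb 8 x).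
  (* [B * sin phi] is the imaginary part; [u_k] is [sin (k phi) / sin phi]. *)
  set (u2 := 2 * x); set (u3 := 2 * x * u2 - 1); set (u4 := 2 * x * u3 - u2);
  set (u5 := 2 * x * u4 - u3); set (u6 := 2 * x * u5 - u4);
  set (u7 := 2 * x * u6 - u5); set (u8 := 2 * x * u7 - u6).
  set (B := -3 * u2 + 5 * u3 + 29 * u4 + 55 * u5 + 62 * u6 + 44 * u7 + 17 * u8).
  (* Real part squared plus imaginary part squared, an identity of polynomials in [x]. *)
  replace (sum_f_R0 _ 8) with (A ^ 2 + (1 - x ^ 2) * B ^ 2).
  + generalize (pow2_ge_0 A) (pow2_ge_0 B); nra.
  + unfold A, B, u8, u7, u6, u5, u4, u3, u2; cbn [sum_f_R0 cheb good]; ring.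
Qed.

Lemma v_good : v 8 good <= 34.7.
Proof.
unfold v; rewrite cos_poly_at_0; cbn [sum_f_R0 good].
assert (H1 : sqrt 17222 * sqrt 17222 = 17222) by (apply sqrt_sqrt; lra).
assert (H0 : sqrt 9970 * sqrt 9970 = 9970) by (apply sqrt_sqrt; lra).
pose proof (sqrt_pos 17222); pose proof (sqrt_pos 9970).
(* Both roots are rounded so as to shrink their difference, bounding the denominator of [v] from
   below. *)
assert (131.232 <= sqrt 17222) by nra.
assert (sqrt 9970 <= 99.85) by nra.
apply Rle_div_l; [apply Rlt_gt, pow_lt; lra|nra].
Qed.

Theorem theorem8p1 :
  V 8 = Rbar_glb (fun y : Rbar => exists a : R,
          1.6566924 <= a <= 1.8191095 /\
          y = Rbar_div (chi 8 a) (Finite ((sqrt a - 1) ^ 2))).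
Proof.
apply (V_eq_glb 8 (fun a => 1.6566924 <= a <= 1.8191095) good).
- intros a Ha; lra.
- exact InC_good.
- cbn [good]; lra.
- intros c Hc Hout; apply Rle_trans with 34.7;
    [exact v_good | now apply v_outside].
Qed.
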